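(* The star Menger property is not necessarily inherited by regular closed subsets: there exist a star Menger space $X$ and a regular closed subset $Y$ of $X$ such that $Y$, with the subspace topology, is not star Menger.
   Context: All spaces are assumed to be regular and $T_1$. For a family $\mathcal{U}$ of subsets of $X$ and $A\subseteq X$, $St(A,\mathcal{U})=\bigcup\{U\in\mathcal{U}:U\cap A\neq\emptyset\}$. A space $M$ is Menger if for every sequence $\{\mathcal{U}_n:n\in\omega\}$ of open covers of $M$ there are finite subcollections $\mathcal{V}_n\subseteq\mathcal{U}_n$ ($n\in\omega$) such that $\bigcup\{\mathcal{V}_n:n\in\omega\}$ is an open cover of $M$. A space $X$ is star Menger if for every open cover $\mathcal{U}$ of $X$ there is a subspace $M\subseteq X$ which is Menger and satisfies $St(M,\mathcal{U})=X$. A subset is regular closed if it equals the closure of its interior. *)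

(* Defs.v *)
From mathcomp Require Import all_boot all_order all_algebra.
From mathcomp Require Import all_classical.
From mathcomp Require Import topology.

Set Implicit Arguments.
Unset Strict Implicit.
Unset Printing Implicit Defensive.

Local Open Scope classical_set_scope.

(* Subspaces are the types [set_type A], carrying the initial topology along
   the inclusion; the library's [subspace A] is not used because it keeps the
   points outside [A] (as isolated points). *)

Section StarMenger.
Variable T : topologicalType.

Definition open_cover (U : set (set T)) : Prop :=
  (forall A, U A -> open A) /\ cover U id = [set: T].

Definition star (A : set T) (U : set (set T)) : set T :=
  \bigcup_(B in [set B | U B /\ B `&` A !=set0]) B.

Definition menger_space : Prop :=
  forall U : nat -> set (set T), (forall n, open_cover (U n)) ->
  exists V : nat -> set (set T),
    (forall n, V n `<=` U n /\ finite_set (V n)) /\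
    open_cover (\bigcup_n V n).

End StarMenger.

Arguments menger_space : clear implicits.

Definition star_menger_space (T : topologicalType) : Prop :=
  forall U : set (set T), open_cover U ->
  exists M : set T, menger_space (set_type M) /\ star M U = [set: T].

Arguments star_menger_space : clear implicits.

(* Main.v *)
(* Let W be omega_1, realised by pairwise distinct branches of the binary tree.
   Y is the plank A(W) x (omega_1 + 1) without its corner (A(W) the one-point
   compactification of the discrete W), and X attaches to the top edge
   W x {omega_1} the countable set of tree nodes, each top point d being the
   limit of the nodes on its branch.  A(W) x omega_1 is countably compact, so
   for any open cover it lies in the star of a finite set, and the nodes catch
   the top points: a countable set suffices in X.  In Y, take as the only
   neighbourhood of the top point d in the cover the part {d} x (d, omega_1] of
   its column.  A Menger subspace is covered by countably many sets
   (column of g) u A(W) x [0, g], so it misses {d} x (d, omega_1] as soon as d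
   exceeds all these g. *)

Require Import Defs.
From HB Require Import structures.
From mathcomp Require Import all_boot all_order all_algebra.
From mathcomp Require Import wochoice all_classical.
From mathcomp Require Import topology.

Set Implicit Arguments.
Unset Strict Implicit.
Unset Printing Implicit Defensive.

Import Order.TTheory.

Local Open Scope classical_set_scope.

(** * Countability, and a copy of omega_1 among the binary sequences *)

Lemma countable_injective (T U : Type) (f : T -> U) (A : set T) (B : set U) :
  injective f -> (forall x, A x -> B (f x)) -> countable B -> countable A.
Proof.
move=> finj AB /countable_injP[g ginj]; apply/countable_injP; exists (g \o f).
move=> x y /set_mem Ax /set_mem Ay /ginj e; apply: finj; apply: e; apply: mem_set.
  exact: AB.
exact: AB.
Qed.

Lemma uncountable_cantor : ~ countable [set: nat -> bool].
Proof.
move/countable_injP => [g ginj'].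
have ginj x y : g x = g y -> x = y by move=> e; apply: ginj'; rewrite ?in_setT.
pose h n := ~~ `[< exists x, g x = n /\ x n >].
have : h (g h) = ~~ h (g h).
  rewrite {1}/h; congr (~~ _); apply/asboolP/idP => [[x [/ginj ->]]//|hh].
  by exists h.
by case: (h _).
Qed.

(** These three conditions characterise the order type omega_1. *)
Definition omega1_like d (W : orderType d) : Prop :=
  [/\ forall A : set W, A !=set0 ->
        exists2 m, A m & forall x, A x -> (m <= x)%O,
      forall x : W, countable [set y | (y < x)%O] &
      ~ countable [set: W]].

(** Carving omega_1 out of a well-ordering of [nat -> bool] makes the inclusion the required
    injection into branches. *)
Lemma exists_omega1 : exists (d : Order.disp_t) (W : orderType d),
  omega1_like W /\ exists f : W -> nat -> bool, injective f.
Proof.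
have [R Rwo] := well_ordering_principle (nat -> bool).
have Rwo' : @wo_chain (nat -> bool) R predT by move=> A _; exact: Rwo.
have Rtot x y : R x y || R y x by apply: (wo_chainW Rwo').
have Ranti x y : R x y && R y x -> x = y.
  by apply: (wo_chain_antisymmetric Rwo').
have Rmin (A : set (nat -> bool)) : A !=set0 ->
    exists2 m, A m & forall x, A x -> R m x.
  move=> [x Ax]; have /Rwo[m [[mA mmin] _]] : wochoice.nonempty (fun y => y \in A).
    by exists x; exact: mem_set.
  by exists m => [|y Ay]; [exact: set_mem|apply: mmin; exact: mem_set].
have Rtr y x z : R x y -> R y z -> R x z.
  move=> xy yz.
  (* The least of the three points is [x], or antisymmetry identifies it with the point before
     it. *)
  have [|m Am mm] := Rmin [set x; y; z]; first by exists x; left; left.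
  have [mx my mz] : [/\ R m x, R m y & R m z].
    by split; apply: mm; [left; left|left; right|right].
  case: Am => [[mE|mE]|mE]; rewrite mE in mx my mz => //.
    by rewrite (Ranti x y) // xy.
  by rewrite -(Ranti y z) // yz.
(* The points with countable initial segment form the copy of omega_1. *)
pose A : set (nat -> bool) := [set x | countable [set y | ~~ R x y]].
have Auncount : ~ countable A.
  (* If [A] is everything, Cantor applies; otherwise the least point outside [A] has all its strict
     predecessors in [A], so it would lie in [A]. *)
  move=> cA; have [[x nAx]|AT] := pselect (~` A !=set0); last first.
    apply: uncountable_cantor; apply: sub_countable cA; apply: subset_card_le.
    by move=> x _; apply: contrapT => nAx; apply: AT; exists x.
  have [|m nAm mmin] := Rmin (~` A); first by exists x.
  apply: nAm; apply: sub_countable cA; apply: subset_card_le => y /=.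
  by move=> nRmy; apply: contrapT => /mmin; apply/negP.
pose T := set_type A.
pose le (x y : T) := R (val x) (val y).
have lexx : reflexive le by move=> x; rewrite /le -[R _ _]orbb Rtot.
have lea : antisymmetric le by move=> x y /Ranti; exact: val_inj.
have let_ : transitive le by move=> y x z; exact: Rtr.
have letot : total le by move=> x y; exact: Rtot.
pose d := Order.default_display.
pose W0 : porderType d := HB.pack T (Order.Le_isPOrder.Build d T lexx lea let_).
pose W : orderType d :=
  HB.pack T (Order.POrder.on W0) (Order.POrder_isTotal.Build d W0 letot).
exists d, W; split; last by exists (val : T -> nat -> bool); exact: val_inj.
split.
- move=> B [b Bb].
  have [|_ [m Bm <-] mmin] := Rmin (val @` (B : set T)); first by exists (val b), b.
  by exists m => // x Bx; apply: (mmin (val x)); exists x.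
- move=> x; apply: (@countable_injective T _ val _ [set y | ~~ R (val x) y]).
  + exact: val_inj.
  + by move=> y; rewrite /= ltNge.
  + exact: (set_mem (valP (x : T))).
- move=> cW; apply: Auncount; apply: sub_countable cW.
  apply: card_le_trans (card_image_le (val : T -> _) setT).
  apply: subset_card_le => x Ax; exists (SigSub (mem_set Ax)) => //.
Qed.

(** * Menger subspaces *)

Lemma countable_menger (T : topologicalType) :
  countable [set: T] -> menger_space T.
Proof.
move=> /countable_injP[g ginj] U Uc.
have /choice[c cP] : forall xn : T * nat, exists A, U xn.2 A /\ A xn.1.
  move=> [x n] /=; have [_ UT] := Uc n.
  by have [A UA Ax] : cover (U n) id x; [rewrite UT|exists A].
(* From the n-th cover, keep only the set chosen around the point numbered [n], if there is one. *)
exists (fun n => [set A | exists2 x, g x = n & A = c (x, n)]); split.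
  move=> n; split; first by move=> _ [x _ ->]; have [] := cP (x, n).
  have [[x gx]|no] := pselect (exists x, g x = n).
    apply: (sub_finite_set _ (finite_set1 (c (x, n)))) => _ [y gy ->] /=.
    by rewrite (ginj y x) ?in_setT// gx.
  by apply: (sub_finite_set _ (finite_set0 _)) => A [y gy _]; apply: no; exists y.
split.
  by move=> A [n _ [x _ ->]]; have [oU _] := Uc n; apply: oU; have [] := cP (x, n).
rewrite predeqE => x; split => // _.
by exists (c (x, g x)); [exists (g x) => //; exists x|have [] := cP (x, g x)].
Qed.

(** Menger implies Lindelöf: take a constant sequence of covers. The conclusion is about indices
    because a countable set of indices can be bounded in omega_1. *)
Lemma menger_countable_subcover (T : topologicalType) (M : set T) (I : Type)
    (U : I -> set T) :
  menger_space (set_type M) -> (forall i, open (U i)) -> M `<=` \bigcup_i U i ->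
  exists2 C : set I, countable C & M `<=` \bigcup_(i in C) U i.
Proof.
move=> mM oU MU.
pose P i : set (set_type M) := val @^-1` U i.
have [n|V [VP [_ VT]]] := mM (fun=> range P).
  split; first by move=> _ [i _ <-]; exists (U i).
  rewrite predeqE => x; split => // _.
  by have [i _ Ui] := MU _ (set_mem (valP x)); exists (P i) => //; exists i.
have [M0|[x0 Mx0]] : M = set0 \/ M !=set0.
  by have [->|/set0P] := eqVneq M set0; [left|right].
  by exists set0 => //; rewrite M0.
have [i0 _ _] := MU _ Mx0.
have /choice[c cP] : forall A, exists i, range P A -> P i = A.
  move=> A; have [[i _ <-]|] := pselect (range P A); first by exists i.
  by exists i0.
exists (c @` \bigcup_n V n).
  apply: sub_countable (card_image_le c _) _.
  apply: bigcup_countable => // n _; apply: finite_set_countable.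
  by have [] := VP n.
move=> x Mx; pose xM : set_type M := SigSub (mem_set Mx).
have [A VA Ax] : cover (\bigcup_n V n) id xM by rewrite VT.
exists (c A); first by exists A.
have /cP PcA : range P A by case: VA => n _ /(proj1 (VP n)).
by have : P (c A) xM by rewrite PcA.
Qed.

(** * The topology of the plank with the tree attached: regular and T_1 *)

Section PlankOverTree.
Context {d0 : Order.disp_t} {W : orderType d0}.

(* [Node t] is a node of the binary tree, [Top d] is the point (d, omega_1), and
   [Pt a al] is the point (a, al), where [a = None] stands for the point at
   infinity of A(W).  The index [f] is used only by the topology. *)
Inductive plank (f : W -> nat -> bool) : Type :=
  | Node of seq bool
  | Top of W
  | Pt of option W & W.

Variable f : W -> nat -> bool.
Local Notation X := (plank f).

HB.instance Definition _ := gen_eqMixin X.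
HB.instance Definition _ := gen_choiceMixin X.

(* The bounds are finite sets [s] rather than single elements of [W], so that
   two basic neighbourhoods are intersected by concatenation. *)
Definition base_nbhs (x : X) (s : seq W) (n : nat) : set X := fun y =>
  match x, y with
  | Node t, Node t' => t' = t
  | Top d, Top d' => d' = d
  | Top d, Node t => (n <= size t)%N /\ t = mkseq (f d) (size t)
  | Top d, Pt a al => a = Some d /\ {in s, forall g, g < al}%O
  | Pt a al, Pt b be =>
      [/\ (be <= al)%O,
          b = a \/ (a = None /\ {in s, forall g, b <> Some g}) &
          {in s, forall g, g < al -> g < be}%O]
  | _, _ => False
  end.

Lemma base_nbhs_refl x s n : base_nbhs x s n x.
Proof. by case: x => [t|d|a al] //=; split=> //; left. Qed.

Lemma base_nbhs_sub x s s' n n' : {subset s <= s'} -> (n <= n')%N ->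
  base_nbhs x s' n' `<=` base_nbhs x s n.
Proof.
move=> ss' nn' y; case: x => [t|d|a al]; case: y => [t'|d'|b be] //=.
- by case=> /(leq_trans nn').
- by case=> -> al; split => // g /ss'; exact: al.
- case=> ba bad gal; split => // [|g /ss']; last exact: gal.
  by case: bad => [|[? bs]]; [left|right; split => // g /ss'; exact: bs].
Qed.

(** The same [s] and [n] serve around every point [y] of a basic neighbourhood, which is why these
    sets are open. *)
Lemma base_nbhs_trans x y s n :
  base_nbhs x s n y -> base_nbhs y s n `<=` base_nbhs x s n.
Proof.
move=> xy z; case: x xy => [t|d|a al]; case: y => [t'|d'|b be] //=;
  case: z => [t''|d''|c ga] //=.
- by move=> -> ->.
- by move=> [? ?] ->.
- by move=> ->.
- by move=> ->.
- by move=> ->.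
- move=> [-> sbe] [_ cb sga]; split; first by case: cb => [//|[]].
  by move=> g gs; apply: sga => //; exact: sbe.
- move=> [ba bad sbe] [cb cbd sga]; split; first exact: le_trans ba.
  + by case: cbd bad => [->//|[-> cs]] [<-|[-> ?]]; right.
  + by move=> g gs gal; apply: sga => //; exact: sbe.
Qed.

Definition plank_open (O : set X) : Prop :=
  forall x, O x -> exists s n, base_nbhs x s n `<=` O.

Lemma plank_openT : plank_open setT.
Proof. by move=> x _; exists [::], 0%N. Qed.

Lemma plank_openI : setI_closed plank_open.
Proof.
move=> A B oA oB x [/oA[s [n sA]] /oB[s' [n' sB]]].
exists (s ++ s'), (maxn n n') => y xy; split.
  apply/sA/(base_nbhs_sub _ _ xy); last by rewrite leq_maxl.
  exact: mem_subseq (prefix_subseq _ _).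
apply/sB/(base_nbhs_sub _ _ xy); last by rewrite leq_maxr.
exact: mem_subseq (suffix_subseq _ _).
Qed.

Lemma plank_open_bigU (I : Type) (O : I -> set X) :
  (forall i, plank_open (O i)) -> plank_open (\bigcup_i O i).
Proof.
move=> oO x [i _ /oO[s [n sO]]]; exists s, n => y /sO ?; by exists i.
Qed.

HB.instance Definition _ :=
  isOpenTopological.Build X plank_openT plank_openI plank_open_bigU.

Lemma open_base_nbhs x s n : open (base_nbhs x s n).
Proof. by move=> y xy; exists s, n; exact: base_nbhs_trans. Qed.

Lemma nbhs_plankP (x : X) (O : set X) :
  nbhs x O <-> exists s n, base_nbhs x s n `<=` O.
Proof.
rewrite nbhsE; split => [[V [oV Vx] VO]|[s [n sO]]].
  by have [s [n sV]] := oV x Vx; exists s, n; exact: subset_trans VO.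
exists (base_nbhs x s n) => //; split; first exact: open_base_nbhs.
exact: base_nbhs_refl.
Qed.

Hypothesis finj : injective f.

(** A clopen base gives regularity. Injectivity of [f] separates two top points, whose branches part
    at some level. *)
Lemma closed_base_nbhs x s n : closed (base_nbhs x s n).
Proof.
rewrite -openC; change (plank_open (~` base_nbhs x s n)) => y nxy.
case: x nxy => [t|d|a al]; case: y => [t'|d'|b be] /= nxy.
- by exists [::], 0%N; case=> //= t'' ->.
- exists [::], (size t).+1; case=> //= t'' [tt _] te.
  by rewrite te ltnn in tt.
- by exists [::], 0%N; case.
- by exists [::], 0%N; case=> //= t'' ->.
- have [k kP] : exists k, f d k <> f d' k.
    apply: contrapT => nk; apply: nxy; apply: finj; apply: funext => k.
    by apply/esym; apply: contrapT => ?; apply: nk; exists k.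
  (* Nodes of length above [k] record the bit at which the branches differ. *)
  exists [::], k.+1; case=> //= [t|d''|b be].
  + move=> [kt te] [_ te']; apply: kP.
    by rewrite -(nth_mkseq false (f d) kt) -te' te nth_mkseq.
  + by move=> ->.
  + by move=> [-> _] [[dd] _]; exact: nxy.
- exists [:: d], 0%N; case=> //= c ga [cb cbd _] [ce sga].
  case: cbd => [cE|[bN /(_ d (mem_head _ _))]//].
  apply: nxy; split; first by rewrite -cE.
  by move=> g /sga; move/lt_le_trans; apply.
- by exists [::], 0%N; case.
- by exists [:: al], 0%N; case=> //= c ga [_ /(_ al (mem_head _ _)) lt] [];
    rewrite leNgt lt.
- exists (al :: (if a is Some d then [:: d] else [::]) ++ s), 0%N.
  case=> //= c ga [gb cb sga] [ca cad sga'].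
  apply: nxy; split.
  + rewrite leNgt; apply/negP => /(sga _ (mem_head _ _)).
    by rewrite ltNge ca.
  + case: cb => [<-//|[bN cs]].
    case: cad => [ca'|[aN _]].
      case: a ca' cs {sga sga'} => [d|]; last by move=> _ _; right; rewrite bN.
      by move=> -> /(_ d); rewrite !inE eqxx orbT => /(_ isT)/(_ erefl).
    by left; rewrite aN.
  + by move=> g gs gal; apply: lt_le_trans gb; exact: sga'.
Qed.

Lemma plank_regular : regular_space X.
Proof.
move=> x O /nbhs_plankP[s [n sO]]; exists (base_nbhs x s n).
  by apply/nbhs_plankP; exists s, n.
by rewrite -(closure_id _).1 //; exact: closed_base_nbhs.
Qed.

Lemma plank_accessible : accessible_space X.
Proof.
move=> x y /eqP xy.
have [s [n nxy]] : exists s n, ~ base_nbhs x s n y.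
  case: x xy => [t|d|a al]; case: y => [t'|d'|b be] /= xy;
    try by exists [::], 0%N => //.
  - by exists [::], 0%N => tt; apply: xy; rewrite tt.
  - by exists [::], (size t').+1; case; rewrite ltnn.
  - by exists [::], 0%N => tt; apply: xy; rewrite tt.
  - by exists [:: be], 0%N => -[_ /(_ be (mem_head _ _))]; rewrite ltxx.
  - exists (be :: (if b is Some d then [:: d] else [::])), 0%N => -[ba bad sb].
    apply: xy; congr (Pt f).
      case: bad => [->//|[-> bs]]; case: b bs {sb} => // d /(_ d).
      by rewrite !inE eqxx orbT => /(_ isT)/(_ erefl).
    apply/eqP; rewrite eq_le ba andbT leNgt; apply/negP => /(sb _ (mem_head _ _)).
    by rewrite ltxx.
exists (base_nbhs x s n); split; first exact: open_base_nbhs.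
  by apply/mem_set/base_nbhs_refl.
exact/mem_set.
Qed.

End PlankOverTree.

(** * Countable compactness and the star Menger property *)

Section Omega1.
Context {d0 : Order.disp_t} {W : orderType d0}.
Hypothesis W1 : omega1_like W.

(** Otherwise [W] would be a countable union of countable initial segments. *)
Lemma omega1_bounded (C : set W) :
  countable C -> exists x, forall y, C y -> (y < x)%O.
Proof.
have [_ cinit ncW] := W1 => cC; apply: contrapT => nb; apply: ncW.
apply: (@sub_countable _ _ _ (\bigcup_(y in C) ([set z | (z < y)%O] `|` [set y]))).
  apply: subset_card_le => x _; apply: contrapT => nx; apply: nb; exists x => y Cy.
  by rewrite ltNge le_eqVlt; apply/negP => /orP[/eqP xy|xy]; apply: nx;
    exists y => //; [right|left].
apply: bigcup_countable => // y _.
suff -> : [set z | (z < y)%O] `|` [set y] = \bigcup_(i in [set: bool])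
    (if i then [set z | (z < y)%O] else [set y]).
  by apply: bigcup_countable => // -[] _; [exact: cinit|exact: countable1].
apply/seteqP; split => [z [zy|zy]|z [[] _ zy]]; by [exists true|exists false|left|right].
Qed.

(** Countable compactness of omega_1: [be] is the least level below which infinitely many terms
    stay, so only finitely many stay below a smaller [g]. *)
Lemma omega1_cluster (al : nat -> W) (S : set nat) : infinite_set S ->
  exists be, infinite_set (S `&` [set k | (al k <= be)%O]) /\
    forall g, (g < be)%O -> finite_set (S `&` [set k | (al k <= g)%O]).
Proof.
have [Wmin _ _] := W1 => Sinf.
have [x xP] : exists x, forall k, (al k < x)%O.
  have [|x xP] := @omega1_bounded (range al); last first.
    by exists x => k; apply: xP; exists k.
  exact: sub_countable (card_image_le _ _) _.
have [|be beinf bemin] :=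
    Wmin [set z | infinite_set (S `&` [set k | (al k <= z)%O])].
  exists x => /=; rewrite (_ : _ `&` _ = S)//.
  by apply/seteqP; split => [k []//|k Sk]; split => //=; exact/ltW.
exists be; split => // g gbe; apply: contrapT => /bemin.
by rewrite leNgt gbe.
Qed.

Variable f : W -> nat -> bool.

(** Some column is visited infinitely often, or the columns tend to infinity in A(W). Along that
    subsequence the heights cluster by [omega1_cluster]. *)
Lemma plank_cluster (a : nat -> option W) (al : nat -> W) :
  exists b be, forall s n,
    infinite_set [set k | base_nbhs (Pt f b be) s n (Pt f (a k) (al k))].
Proof.
have [b [S [Sinf Sfin]]] : exists b S, infinite_set S /\ forall s : seq W,
    finite_set [set k | S k /\
      ~ (a k = b \/ (b = None /\ {in s, forall g, a k <> Some g}))].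
  have [[d dinf]|no] := pselect (exists d, infinite_set [set k | a k = Some d]).
    exists (Some d), [set k | a k = Some d]; split => // s.
    by apply: (sub_finite_set _ (finite_set0 _)) => k [/= ak]; apply; left.
  exists None, setT; split; first exact: infinite_nat.
  move=> s; apply: (sub_finite_set _ (_ : finite_set
      (\bigcup_(g in [set` s]) [set k | a k = Some g]))).
    move=> k [_ nk]; apply: contrapT => ns; apply: nk; right; split => // g gs ak.
    by apply: ns; exists g.
  apply: bigcup_finite; first exact: finite_seq.
  by move=> g _; apply: contrapT => ginf; apply: no; exists g.
(* [S] is a subsequence along which [a] converges to [b]. *)
have [be [beinf befin]] := omega1_cluster al Sinf.
exists b, be => s n.
pose F := [set k | S k /\
      ~ (a k = b \/ (b = None /\ {in s, forall g, a k <> Some g}))] `|`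
  \bigcup_(g in [set` s] `&` [set g | (g < be)%O])
     (S `&` [set k | (al k <= g)%O]).
have Ffin : finite_set F.
  rewrite /F finite_setU; split; first exact: Sfin.
  apply: bigcup_finite; last by move=> g [_]; exact: befin.
  by apply: (sub_finite_set _ (finite_seq s)) => g [].
have := infinite_setD beinf Ffin; apply: contra_not.
apply: sub_finite_set => k [[Sk ak] /not_orP[nk1 nk2]] /=; split => //.
  by apply: contrapT => ?; apply: nk1.
move=> g gs gbe; rewrite ltNge; apply/negP => ag; apply: nk2; by exists g.
Qed.

(** Otherwise choose points one by one, each outside the star of the earlier ones; a member of [U]
    around a cluster point contains two of them, a contradiction. *)
Lemma plank_star_finite (U : set (set (plank f))) : open_cover U ->
  exists s : seq (plank f),
    [set Pt f p.1 p.2 | p in [set: option W * W]] `<=` star [set` s] U.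
Proof.
move=> [oU UT]; apply: contrapT => nos.
have /choice[g gP] : forall s : seq (plank f), exists p : option W * W,
    ~ star [set` s] U (Pt f p.1 p.2).
  move=> s; apply: contrapT => ns; apply: nos; exists s => _ [p _ <-].
  by apply: contrapT => np; apply: ns; exists p.
pose h s := Pt f (g s).1 (g s).2.
(* [l n] lists the first [n] chosen points, and [h (l n)] is the next one. *)
pose l n := iter n (fun s => h s :: s) [::].
have lP i n : (i < n)%N -> h (l i) \in l n.
  elim: n => // n IH; rewrite ltnS leq_eqVlt => /orP[/eqP ->|/IH hl].
    by rewrite /l /= inE eqxx.
  by rewrite /l /= inE hl orbT.
have [b [be cl]] := plank_cluster (fun n => (g (l n)).1) (fun n => (g (l n)).2).
have [O UO Ob] : cover U id (Pt f b be) by rewrite UT.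
have /nbhs_plankP[s [n sO]] : nbhs (Pt f b be) O.
  by apply: open_nbhs_nbhs; split => //; exact: oU.
have Oinf : infinite_set [set k | O (h (l k))].
  by have := cl s n; apply: contra_not; apply: sub_finite_set => k; exact: sO.
have [i Oi] : [set k | O (h (l k))] !=set0 by exact: infinite_setN0.
have [j [Oj /negP]] : ([set k | O (h (l k))] `\` `I_i.+1) !=set0.
  by apply: infinite_setN0; exact: infinite_setD.
rewrite -leqNgt => ij; apply: (gP (l j)); exists O => //=; split => //.
by exists (h (l i)); split => //=; exact: lP.
Qed.

Lemma plank_star_menger : star_menger_space (plank f).
Proof.
move=> U Uc; have [s sP] := plank_star_finite Uc.
(* Every neighbourhood of a top point contains nodes of its branch, so the nodes handle nodes and
   top points, and [s] handles the rest. *)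
exists (range (Node f) `|` [set` s]); split.
  apply: countable_menger.
  apply: (@countable_injective _ _ val _ (range (Node f) `|` [set` s])).
  - exact: val_inj.
  - by move=> x _; exact: (set_mem (valP x)).
  - suff -> : range (Node f) `|` [set` s] = \bigcup_(i in [set: bool])
        (if i then range (Node f) else [set` s]).
      apply: bigcup_countable => // -[] _.
        exact: sub_countable (card_image_le _ _) _.
      exact/finite_set_countable/finite_seq.
    apply/seteqP; split => [z [zy|zy]|z [[] _ zy]];
      by [exists true|exists false|left|right].
have [oU UT] := Uc; rewrite predeqE => x; split => // _.
have [O UO Ox] : cover U id x by rewrite UT.
case: x Ox => [t|d|a al] Ox.
- by exists O => //; split => //; exists (Node f t); split => //; left; exists t.
- exists O => //; split => //.
  have /nbhs_plankP[s' [n sO]] : nbhs (Top f d) O.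
    by apply: open_nbhs_nbhs; split => //; exact: oU.
  exists (Node f (mkseq (f d) n)); split.
    by apply: sO => /=; rewrite size_mkseq.
  by left; exists (mkseq (f d) n).
- have [O' [UO' [y [O'y sy]]] O'x] : star [set` s] U (Pt f a al).
    by apply: sP; exists (a, al).
  by exists O' => //; split => //; exists y; split => //; right.
Qed.

(** * A regular closed part that is not star Menger *)

Definition plank_part : set (plank f) := ~` range (Node f).

(** Nodes are isolated, so the part is closed; every [Pt] is interior, and each top point is a limit
    of its own column. *)
Lemma plank_part_regclosed : regclosed plank_part.
Proof.
rewrite /regclosed; apply/seteqP; split.
  apply: (@subset_trans _ (closure plank_part)).
    by apply: closureS; exact: interior_subset.
  rewrite -(closure_id _).1 //; rewrite /plank_part -openC setCK.
  move=> _ [t _ <-]; exists [::], 0%N; case => //= t' ->.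
  by exists t.
have PtI a al : plank_part° (Pt f a al).
  by apply/nbhs_plankP; exists [::], 0%N; case => // b be _ [].
move=> [t|d|a al] Yx.
- by case: Yx; exists t.
- move=> O /nbhs_plankP[s [n sO]].
  have [x xs] := omega1_bounded (finite_set_countable (finite_seq s)).
  by exists (Pt f (Some d) x); split => //; apply: sO.
- exact: subset_closure.
Qed.

Lemma plank_part_not_star_menger : ~ star_menger_space (set_type plank_part).
Proof.
(* In the cover by [P] and all [V d], only [V d] contains [Top f d]. Including the nodes makes [V d]
   the trace of an open set of the whole space. *)
pose V d : set (set_type plank_part) := val @^-1` (fun x : plank f => match x with
  | Node _ => True | Top d' => d' = d
  | Pt a al => a = Some d /\ (d < al)%O end).
pose P : set (set_type plank_part) :=
  val @^-1` (fun x : plank f => if x is Pt _ _ then True else False).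
pose Q g : set (set_type plank_part) := val @^-1` (fun x : plank f => match x with
  | Node _ => True | Top d => d = g
  | Pt a al => a = Some g \/ (al <= g)%O end).
have openY (A : set (plank f)) : plank_open A ->
    open (val @^-1` A : set (set_type plank_part)) by move=> oA; exists A.
have oV d : open (V d).
  apply: openY => -[t|d' ->|a al [-> dal]] //.
  - by exists [::], 0%N; case.
  - by exists [:: d], 0%N; case=> //= a al [-> /(_ d (mem_head _ _))].
  - exists [:: d], 0%N; case=> //= b be [_ bS gbe]; split; first by case: bS => [|[]].
    by apply: gbe => //; exact: mem_head.
have oP : open P.
  by apply: openY => -[//|//|a al] _; exists [::], 0%N; case=> // b be [].
have oQ g : open (Q g).
  apply: openY => -[t|d ->|a al [->|alg]] //.
  - by exists [::], 0%N; case.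
  - by exists [::], 0%N; case=> //= a al [-> _]; left.
  - by exists [::], 0%N; case=> //= b be [_ [->|[]//] _]; left.
  - by exists [::], 0%N; case=> //= b be [bal _ _]; right; exact: le_trans alg.
move=> /(_ (P |` range V))[|M [mM MT]].
  split; first by move=> _ [->|[d _ <-]].
  rewrite predeqE => y; split => // _.
  case E : (val y) => [t|d|a al].
  - by have := set_mem (valP y); rewrite E => -[]; exists t.
  - by exists (V d); [right; exists d|rewrite /V /= E].
  - by exists P; [left|rewrite /P /= E].
have [|C cC MC] := menger_countable_subcover mM oQ.
  move=> y _; case E : (val y) => [t|d|a al].
  - by have := set_mem (valP y); rewrite E => -[]; exists t.
  - by exists d => //; rewrite /Q /= E.
  - by exists al => //; rewrite /Q /= E; right.
(* For [g < d], the sets [Q g] and [V d] are disjoint: column [d] enters [Q g] only at heights at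
   most [g]. *)
have [d Cd] := omega1_bounded cC.
have Yd : Top f d \in plank_part by apply: mem_set => -[].
have : star M (P |` range V) (SigSub Yd) by rewrite MT.
case=> A [[->|[d' _ <-]] [x [Ax Mx]]] //=.
rewrite /V /= => dd; rewrite -dd {d' dd} in Ax.
have [g Cg Qx] := MC _ Mx.
move: Ax Qx (Cd g Cg); rewrite /V /Q /=; case E : (val x) => [t|d'|a al].
- by have := set_mem (valP x); rewrite E => -[]; exists t.
- by move=> -> ->; rewrite ltxx.
- move=> [-> dal] [[->]|alg] gd; first by rewrite ltxx in gd.
  by have := lt_trans gd dal; rewrite ltNge alg.
Qed.

End Omega1.

Theorem proposition4p5 :
  exists (X : topologicalType) (Y : set X),
    [/\ regular_space X, accessible_space X, star_menger_space X,
        regclosed Y & ~ star_menger_space (set_type Y)].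
Proof.
have [d [W [W1 [f finj]]]] := exists_omega1.
exists (plank f), (@plank_part _ _ f); split.
- exact: plank_regular.
- exact: plank_accessible.
- exact: plank_star_menger.
- exact: plank_part_regclosed.
- exact: plank_part_not_star_menger.
Qed.
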